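(* For every integer $r \geq 3$ there exists a constant $\mu_r>0$ such that for all $\alpha>0$ and $\varepsilon>0$, \[ \delta\left(\varepsilon, K_r; \frac{2r-5}{2r-3}+\alpha\right) \geq \mu_r \alpha \varepsilon . \] In other words, every $n$-vertex graph $G$ with minimum degree at least $\left(\frac{2r-5}{2r-3}+\alpha\right)n$ and fewer than $\mu_r\alpha\varepsilon n^r$ copies of $K_r$ can be made $K_r$-free by deleting at most $\varepsilon n^2$ edges.
   Context: For a graph $H$ on $h$ vertices, $\varepsilon>0$ and $\gamma\in[0,1]$, $\delta(\varepsilon,H;\gamma)$ denotes the maximum $\delta\in[0,1]$ such that, for every $n$, every $n$-vertex graph with fewer than $\delta n^h$ copies of $H$ (subgraphs isomorphic to $H$) and minimum degree at least $\gamma n$ can be made $H$-free by deleting at most $\varepsilon n^2$ edges. $K_r$ denotes the complete graph on $r$ vertices.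
   Formalization: The lower bound on δ is capped at 1, i.e. δ ≥ min(1, μ_r α ε), because δ ≤ 1 by definition and the stated bound fails once μ_r α ε > 1; the ''in other words'' form is stated without a cap. *)

(* Defs.v *)
From mathcomp Require Import all_boot all_order all_algebra.
From mathcomp Require Import boolp classical_sets reals.

Set Implicit Arguments.
Unset Strict Implicit.
Unset Printing Implicit Defensive.

Import Order.TTheory GRing.Theory Num.Theory.
Local Open Scope ring_scope.

Record sgraph (T : finType) := SGraph {
  edges : {set {set T}};
  edgesP : [forall e in edges, #|e| == 2%N] }.

Definition degree (T : finType) (G : sgraph T) (x : T) : nat :=
  #|[set e in edges G | x \in e]|.

Fact Kgraph_subproof (r : nat) :
  [forall e in [set e : {set 'I_r} | #|e| == 2%N], #|e| == 2%N].
Proof. by apply/forall_inP => e; rewrite inE. Qed.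

Definition Kgraph (r : nat) : sgraph 'I_r := SGraph (Kgraph_subproof r).

(* A subgraph is a pair (vertex set, edge set); copies are unlabelled, so two
   embeddings with the same image are counted once. *)
Definition is_subgraph (T : finType) (G : sgraph T)
    (S : {set T} * {set {set T}}) : bool :=
  (S.2 \subset edges G) && [forall e in S.2, e \subset S.1].

Definition is_iso (U T : finType) (H : sgraph U)
    (S : {set T} * {set {set T}}) : bool :=
  [exists f : {ffun U -> T},
    [&& injectiveb f, S.1 == f @: [set: U]
      & S.2 == [set f @: (e : {set U}) | e in edges H]]].

Definition copies (U T : finType) (H : sgraph U) (G : sgraph T) :
    {set {set T} * {set {set T}}} :=
  [set S | is_subgraph G S && is_iso H S].

Definition Hfree (U T : finType) (H : sgraph U) (G : sgraph T) : Prop :=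
  #|copies H G| = 0%N.

Fact del_edges_subproof (T : finType) (G : sgraph T) (D : {set {set T}}) :
  [forall e in edges G :\: D, #|e| == 2%N].
Proof.
apply/forall_inP => e; rewrite inE => /andP[_ eG].
exact: (forall_inP (edgesP G)).
Qed.

Definition del_edges (T : finType) (G : sgraph T) (D : {set {set T}}) :
  sgraph T := SGraph (del_edges_subproof G D).

Definition can_be_made_Hfree (R : realType) (U T : finType) (H : sgraph U)
    (G : sgraph T) (m : R) : Prop :=
  exists D : {set {set T}},
    [/\ D \subset edges G, (#|D|)%:R <= m & Hfree H (del_edges G D)].

Definition min_degree_ge (R : realType) (T : finType) (G : sgraph T) (m : R) :
  Prop := forall x : T, m <= (degree G x)%:R.

Definition admissible (R : realType) (U : finType) (eps : R) (H : sgraph U)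
    (gamma d : R) : Prop :=
  forall (T : finType) (G : sgraph T),
    (#|copies H G|)%:R < d * (#|T|)%:R ^+ #|U| ->
    min_degree_ge G (gamma * (#|T|)%:R) ->
    can_be_made_Hfree H G (eps * (#|T|)%:R ^+ 2).

Definition delta_set (R : realType) (U : finType) (eps : R) (H : sgraph U)
    (gamma : R) : set R :=
  [set d : R | (0 <= d <= 1) /\ admissible eps H gamma d]%classic.

(* This supremum is a maximum: see delta_in and delta_ub. *)
Definition delta (R : realType) (U : finType) (eps : R) (H : sgraph U)
  (gamma : R) : R := sup (delta_set eps H gamma).

Lemma delta_has_sup (R : realType) (U : finType) (eps : R) (H : sgraph U)
  (gamma : R) : has_sup (delta_set eps H gamma).
Proof.
split; last by exists 1 => d [/andP[]].
by exists 0; split; [rewrite lexx ler01 | move=> T G; rewrite mul0r ltrn0].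
Qed.

Lemma delta_ub (R : realType) (U : finType) (eps : R) (H : sgraph U)
  (gamma d : R) : delta_set eps H gamma d -> d <= delta eps H gamma.
Proof. exact/sup_upper_bound/delta_has_sup. Qed.

Lemma delta_in (R : realType) (U : finType) (eps : R) (H : sgraph U)
  (gamma : R) : delta_set eps H gamma (delta eps H gamma).
Proof.
have hs := delta_has_sup eps H gamma.
have [[d0 d0S] _] := hs.
split.
  apply/andP; split; last by apply: ge_sup; [exists d0 | move=> d [/andP[]]].
  by apply: le_trans (delta_ub d0S); case: d0S => /andP[].
move=> T G ltc.
have N0 : 0 <= (#|T|)%:R ^+ #|U| :> R by rewrite exprn_ge0.
have Np : 0 < (#|T|)%:R ^+ #|U| :> R.
  rewrite lt0r N0 andbT; apply: contraTneq ltc => ->.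
  by rewrite mulr0 ltrn0.
rewrite -ltr_pdivrMr // in ltc.
have [d [_ dS] ltd] := sup_adherent (eps := delta eps H gamma -
   (#|copies H G|)%:R / (#|T|)%:R ^+ #|U|) ltac:(by rewrite subr_gt0) hs.
by apply: dS; rewrite -ltr_pdivrMr //; move: ltd; rewrite /delta subKr.
Qed.

(* Main.v *)
(** Take a maximal family [F] of pairwise edge-disjoint [r]-cliques; deleting
    all their edges destroys every [r]-clique, so we may assume that [F] has
    order [eps * n ^ 2] members.  Given an [r]-clique [X], replace its vertices
    one at a time by new ones.  If [Y] is the set of surviving vertices of [X]
    and [V] the set of the [j] new ones, a vertex [u] can be added when it is
    adjacent to all of [V] and misses at most one vertex of [Y].  Counting
    non-adjacencies with weight 2 on [V] and 1 on [Y], the degree condition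
    leaves at least [((r - 3 - j) / (2r - 3) + alpha * (r + j) / 2) * n] such
    [u], which is linear in [n] uniformly in [alpha] except at the last step
    [j = r - 3], where a single factor [alpha] is lost.  So the edges of [X]
    extend to [r]-cliques in order [alpha * n ^ (r - 2)] ways in total, and
    since the cliques in [F] share no edge, each [r]-clique of the graph arises
    from at most [2 ^ r] such extensions. *)
Require Import Defs.
From mathcomp Require Import all_boot all_order all_algebra.
From mathcomp Require Import boolp classical_sets reals.
From mathcomp Require Import fintype finset zify ring lra.
Import Order.TTheory GRing.Theory Num.Theory.
Local Open Scope ring_scope.

Set Implicit Arguments.
Unset Strict Implicit.
Unset Printing Implicit Defensive.

Lemma card_dep_pairs (A B : finType) (P : {set A}) (Q : A -> {set B}) :
  #|[set p : A * B | (p.1 \in P) && (p.2 \in Q p.1)]| = (\sum_(a in P) #|Q a|)%N.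
Proof.
rewrite -sum1dep_card.
under [RHS]eq_bigr => a _ do rewrite -sum1_card.
by rewrite pair_big_dep.
Qed.

(** * Cliques as vertex sets, and copies of the complete graph *)

Section Cliques.
Variables (T : finType) (G : sgraph T).

Definition adj (x y : T) : bool := [set x; y] \in edges G.

Definition clique (K : {set T}) : bool :=
  [forall x in K, forall y in K, (x != y) ==> adj x y].

Definition cliques (r : nat) : {set {set T}} :=
  [set K : {set T} | (#|K| == r) && clique K].

Definition non_nbrs (x : T) : {set T} := [set y | ~~ adj x y].

Lemma adjC x y : adj x y = adj y x.
Proof. by rewrite /adj setUC. Qed.

Lemma adjxx x : adj x x = false.
Proof.
apply/negP => /(forall_inP (edgesP G)).
by rewrite setUid cards1.
Qed.

Lemma cliqueP (K : {set T}) :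
  reflect {in K &, forall x y, x != y -> adj x y} (clique K).
Proof.
apply: (iffP forall_inP) => [H x y xK yK xy | H x xK].
  by have /forall_inP/(_ y yK)/implyP/(_ xy) := H x xK.
by apply/forall_inP => y yK; apply/implyP; exact: H.
Qed.

(** No correction term appears because [x] belongs to [non_nbrs x]. *)
Lemma card_non_nbrs x : (#|non_nbrs x| + degree G x = #|T|)%N.
Proof.
have -> : degree G x = #|[set y | adj x y]|.
  rewrite /degree -(@card_in_imset _ _ (fun y => [set x; y])).
    apply: eq_card => e; rewrite inE; apply/andP/imsetP => [[eG xe] | [y]].
      have /(forall_inP (edgesP G))/cards2P[a [b [_ eab]]] := eG.
      move: xe; rewrite [in x \in _]eab !inE => /orP[] /eqP xa.
        by exists b; [rewrite inE /adj xa -eab | rewrite xa].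
      by exists a; [rewrite inE /adj xa setUC -eab | rewrite xa setUC].
    by rewrite inE => xy ->; split => //; rewrite !inE eqxx.
  move=> y z; rewrite !inE => xy _ /setP/(_ y).
  rewrite !inE eqxx orbT; case: eqP => [yx | _ /esym/eqP //].
  by move: xy; rewrite yx adjxx.
have -> : non_nbrs x = ~: [set y | adj x y] by apply/setP => y; rewrite !inE.
by rewrite addnC cardsC.
Qed.

Lemma cliques_leq_copies r : (#|cliques r| <= #|copies (Kgraph r) G|)%N.
Proof.
apply: leq_trans _ (leq_imset_card fst _); apply: subset_leq_card.
apply/subsetP => K; rewrite inE => /andP[/eqP cK /cliqueP qK].
pose f := [ffun i : 'I_r => enum_val (cast_ord (esym cK) i)].
have fI : injective f.
  by move=> i j; rewrite !ffunE => /enum_val_inj /cast_ord_inj.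
have fK i : f i \in K by rewrite ffunE enum_valP.
have imf : f @: [set: 'I_r] = K.
  apply/eqP; rewrite eqEcard cK card_imset // cardsT card_ord leqnn andbT.
  by apply/subsetP => _ /imsetP[i _ ->].
apply/imsetP.
exists (K, [set f @: (e : {set 'I_r}) | e in edges (Kgraph r)]) => //.
rewrite inE; apply/andP; split.
  apply/andP; split=> /=.
    apply/subsetP => _ /imsetP[e + ->]; rewrite inE => /cards2P[i [j [ij ->]]].
    by rewrite imsetU1 imset_set1; apply: qK => //; rewrite (inj_eq fI).
  apply/forall_inP => _ /imsetP[e _ ->]; rewrite -imf; exact: imsetS (subsetT _).
by apply/existsP; exists f; rewrite /= imf !eqxx !andbT; apply/injectiveP.
Qed.

Lemma copies_cliques r S : S \in copies (Kgraph r) G -> S.1 \in cliques r.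
Proof.
rewrite inE => /andP[/andP[sub _] /existsP[f /and3P[/injectiveP fI /eqP S1 /eqP S2]]].
rewrite inE S1 card_imset // cardsT card_ord eqxx /=.
apply/cliqueP => _ _ /imsetP[i _ ->] /imsetP[j _ ->]; rewrite (inj_eq fI) => ij.
apply: (subsetP sub); rewrite S2; apply/imsetP; exists [set i; j].
  by rewrite inE cards2 ij.
by rewrite imsetU1 imset_set1.
Qed.

(** * Replacing the vertices of a clique one at a time *)

Section Replacement.
Variable r : nat.

(* The sets of [j] new vertices that can replace [j] vertices of [X]; a new
   vertex is allowed to lie in [X], as long as it is not among the survivors. *)
Definition replacements (X : {set T}) (j : nat) : {set {set T}} :=
  [set V : {set T} | (#|V| == j) && [exists Y : {set T},
     [&& Y \subset X, (#|Y| + j == r)%N, [disjoint Y & V] & clique (Y :|: V)]]].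

Lemma replacements0 X : X \in cliques r -> replacements X 0 = [set set0].
Proof.
rewrite inE => /andP[/eqP cX qX]; apply/setP => V; rewrite !inE cards_eq0.
case: eqP => //= ->; apply/existsP; exists X.
by rewrite subxx addn0 cX eqxx setU0 qX disjoints_subset setC0 subsetT.
Qed.

Definition misses (u : T) (A : {set T}) : nat := #|A :&: non_nbrs u|.

Lemma sum_misses (A : {set T}) :
  (\sum_u misses u A = \sum_(x in A) #|non_nbrs x|)%N.
Proof.
under eq_bigr => u _ do rewrite /misses -sum1_card.
rewrite (exchange_big_dep (mem A)) /= => [|u x _]; last by rewrite inE => /andP[].
apply: eq_bigr => x xA; rewrite -sum1_card; apply: eq_bigl => u.
by rewrite !inE xA adjC.
Qed.

(** Weight at most 1 forces [u] to see all of [V] and all but at most one vertex of [Y]; that vertex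
    gives way to [u]. *)
Lemma replacement_step (X V Y : {set T}) j (u : T) :
    (j.+2 < r)%N -> #|V| = j -> Y \subset X -> (#|Y| + j)%N = r ->
    [disjoint Y & V] -> clique (Y :|: V) ->
    (misses u V * 2 + misses u Y <= 1)%N ->
  (u \notin V) && (u |: V \in replacements X j.+1).
Proof.
move=> jr cV YX cY dYV /cliqueP qYV w.
have mV : misses u V = 0 by lia.
have adjV v : v \in V -> adj u v.
  move=> vV; apply: contraT => nuv; move/eqP: mV; rewrite cards_eq0.
  by move=> /eqP/setP/(_ v); rewrite !inE vV nuv.
have uV : u \notin V by apply/negP => /adjV; rewrite adjxx.
(* The vertex to drop is the non-neighbour of [u] in [Y], or an arbitrary one if there is none; [Y]
   has at least 3 vertices since [j.+2 < r]. *)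
have [y yY adjY] : exists2 y, y \in Y & forall z, z \in Y -> z != y -> adj u z.
  have [/eqP|mY] := posnP (misses u Y).
    rewrite cards_eq0 => /eqP/setP H.
    have /card_gt0P[y yY] : (0 < #|Y|)%N by lia.
    exists y => // z zY _; have := H z; rewrite !inE zY /=.
    by move/negbFE.
  have : misses u Y = 1 by lia.
  move/eqP/cards1P => [y /setP H]; exists y.
    by have := H y; rewrite !inE eqxx => /andP[].
  by move=> z zY zy; have := H z; rewrite !inE zY (negbTE zy) => /negbFE.
(* A vertex misses itself, so if [u] lies in [Y] it is the dropped vertex [y]. *)
have uY : u \notin Y :\ y.
  rewrite !inE; apply/negP => /andP[uy uYY].
  by have := adjY u uYY uy; rewrite adjxx.
rewrite uV inE cardsU1 uV cV eqxx /=; apply/existsP; exists (Y :\ y).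
apply/and4P; split.
- exact: subset_trans (subsetDl _ _) YX.
- by move: (cardsD1 y Y); rewrite yY; lia.
- rewrite disjoint_sym disjoints_subset subUset sub1set inE uY /=.
  rewrite -disjoints_subset disjoint_sym.
  exact: disjointWl (subsetDl _ _) dYV.
have adju z : z \in (Y :\ y) :|: V -> adj u z.
  by rewrite !inE => /orP[/andP[zy zY] | /adjV //]; apply: adjY.
have sub z : z \in (Y :\ y) :|: V -> z \in Y :|: V.
  by rewrite !inE => /orP[/andP[_ ->] | ->]; rewrite ?orbT.
rewrite setUCA; apply/cliqueP => a b /setU1P[-> | aA] /setU1P[-> | bB] ab.
- by rewrite eqxx in ab.
- exact: adju.
- by rewrite adjC; apply: adju.
- by apply: qYV => //; apply: sub.
Qed.

Variables (R : realType) (M : R).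
Hypothesis non_nbrs_le : forall x, (#|non_nbrs x|)%:R <= M.

(** Averaging: the total weight is at most [(2 * j + (r - j)) * M = (r + j) * M], and every [u] that
    fails to extend [V] carries weight at least 2. *)
Lemma many_extensions X V j :
    (j.+2 < r)%N -> V \in replacements X j ->
  (#|T|)%:R - (r + j)%:R * M / 2 <=
    (#|[set u | (u \notin V) && (u |: V \in replacements X j.+1)]|)%:R.
Proof.
move=> jr; rewrite inE => /andP[/eqP cV /existsP[Y]].
move=> /and4P[YX /eqP cY dYV qYV].
pose w u := (misses u V * 2 + misses u Y)%N.
set E := [set u | _].
have wE u : u \in ~: E -> (2 <= w u)%N.
  rewrite in_setC ltnNge; apply: contra => wu.
  by rewrite inE; apply: replacement_step cY dYV qYV wu.
have : (#|~: E| * 2 <= \sum_u w u)%N.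
  rewrite -sum_nat_const [leqRHS](bigID (mem (~: E))) /=.
  by apply: leq_trans _ (leq_addr _ _); apply: leq_sum => u; apply: wE.
rewrite big_split /= -big_distrl /= !sum_misses -(ler_nat R) natrD !natrM.
have sumM (A : {set T}) : (\sum_(x in A) #|non_nbrs x|)%:R <= #|A|%:R * M.
  by rewrite natr_sum mulr_natl -sumr_const; apply: ler_sum => x _.
have := sumM V; have := sumM Y; rewrite cV.
have -> : #|Y|%:R = r%:R - j%:R :> R by rewrite -cY natrD addrK.
have <- : (#|E|%:R + #|~: E|%:R = #|T|%:R :> R) by rewrite -natrD cardsC.
rewrite natrD; lra.
Qed.

(** Double counting of the pairs [(V, u)]: a set of [j.+1] vertices arises at most once for each
    choice of its element [u], and [j.+1 <= r]. *)
Lemma replacements_step (X : {set T}) j :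
    (j.+2 < r)%N ->
  (#|replacements X j|)%:R * ((#|T|)%:R - (r + j)%:R * M / 2) <=
    r%:R * (#|replacements X j.+1|)%:R :> R.
Proof.
move=> jr.
pose E (V : {set T}) := [set u | (u \notin V) && (u |: V \in replacements X j.+1)].
apply: (@le_trans _ _ (\sum_(V in replacements X j) #|E V|)%:R).
  rewrite mulr_natl -sumr_const natr_sum; apply: ler_sum => V.
  exact: many_extensions.
rewrite -natrM ler_nat -card_dep_pairs.
apply: (@leq_trans (\sum_(V in replacements X j.+1) #|V|)).
  rewrite -(card_dep_pairs (replacements X j.+1) (fun V => V)).
  rewrite -(@card_in_imset _ _ (fun p => (p.2 |: p.1, p.2))).
    apply: subset_leq_card; apply/subsetP => _ /imsetP[[V u] + ->].
    by rewrite !inE /= => /andP[_ /andP[_ ->]]; rewrite eqxx.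
  move=> [V u] [W v]; rewrite !inE /= => /andP[_ /andP[uV _]] /andP[_ /andP[vW _]].
  move=> [+ uv]; rewrite -uv in vW * => VW.
  by rewrite -(setU1K uV) VW (setU1K vW).
rewrite mulnC -sum_nat_const; apply: leq_sum => V; rewrite inE => /andP[/eqP -> _].
lia.
Qed.

End Replacement.

(** * Edge-disjoint families of cliques *)

Definition edge_disjoint (F : {set {set T}}) : bool :=
  [forall X in F, forall Y in F, (X != Y) ==> (#|X :&: Y| <= 1)%N].

Lemma edge_disjointP (F : {set {set T}}) :
  reflect {in F &, forall X Y, X != Y -> (#|X :&: Y| <= 1)%N} (edge_disjoint F).
Proof.
apply: (iffP forall_inP) => [H X Y XF YF XY | H X XF].
  by have /forall_inP/(_ Y YF)/implyP/(_ XY) := H X XF.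
by apply/forall_inP => Y YF; apply/implyP; exact: H.
Qed.

(** When [r - 2] vertices are new, the survivors form a pair [e], and [K = e :|: V] is an
    [r]-clique. From [K] and [e] one recovers [V = K :\: e] and [X], the only member of [F] that
    contains [e]. The factor [2 ^ r] bounds the choices of [e] inside [K]. *)
Lemma sum_replacements_leq r (F : {set {set T}}) : (2 <= r)%N ->
    edge_disjoint F ->
  (\sum_(X in F) #|replacements r X (r - 2)| <= #|cliques r| * 2 ^ r)%N.
Proof.
move=> r2 /edge_disjointP dF; rewrite -card_dep_pairs.
have -> : (#|cliques r| * 2 ^ r = \sum_(K in cliques r) #|powerset K|)%N.
  rewrite -sum_nat_const; apply: eq_bigr => K; rewrite inE => /andP[/eqP cK _].
  by rewrite card_powerset cK.
rewrite -card_dep_pairs.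
(* The decoding map; its default [set0] is never reached on the pairs [(e :|: V, e)] used below. *)
pose h (p : {set T} * {set T}) :=
  (odflt set0 [pick X in F | p.2 \subset X], p.1 :\: p.2).
apply: leq_trans _ (leq_imset_card h _); apply: subset_leq_card.
apply/subsetP => -[X V]; rewrite !inE /= => /andP[XF /andP[/eqP cV /existsP[e]]].
move=> /and4P[eX /eqP ce deV qeV].
apply/imsetP; exists (e :|: V, e).
  rewrite !inE /= qeV subsetUl !andbT cardsU.
  by move: deV; rewrite -setI_eq0 => /eqP ->; rewrite cards0 subn0 cV ce.
rewrite /h /=; congr (_, _).
  case: pickP => [Y /andP[YF eY] | /(_ X)]; last by rewrite XF eX.
  apply/eqP; apply: contraT => /(dF _ _ XF YF).
  have : e \subset X :&: Y by rewrite subsetI eX.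
  by move/subset_leq_card; lia.
rewrite setDUl setDv set0U; apply/esym/setDidPl.
by rewrite disjoint_sym.
Qed.

End Cliques.

Lemma cliques_del_edges (T : finType) (G : sgraph T) (D : {set {set T}}) r K :
    K \in cliques (del_edges G D) r ->
  K \in cliques G r /\ {in K &, forall x y, x != y -> [set x; y] \notin D}.
Proof.
rewrite !inE => /andP[-> /cliqueP qK]; split.
  by apply/cliqueP => x y xK yK xy; have := qK x y xK yK xy; rewrite /adj inE => /andP[].
by move=> x y xK yK xy; have := qK x y xK yK xy; rewrite /adj inE => /andP[].
Qed.

(** Take [F] maximal and [D] all edges inside its members: a surviving clique would share no edge
    with any member and could be added. The bound on [D] crudely counts all subsets of each
    member. *)
Lemma edge_disjoint_packing (T : finType) (G : sgraph T) r : (2 <= r)%N ->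
  exists F D : {set {set T}},
    [/\ F \subset cliques G r, edge_disjoint F, D \subset edges G,
        (#|D| <= #|F| * 2 ^ r)%N & cliques (del_edges G D) r = set0].
Proof.
move=> r2.
pose P (F : {set {set T}}) := (F \subset cliques G r) && edge_disjoint F.
have P0 : P set0.
  by rewrite /P sub0set; apply/edge_disjointP => X Y; rewrite inE.
have [F /maxsetP[/andP[FK dF] maxF] _] := @maxset_exists _ P set0 P0.
pose D := [set e in edges G | [exists X in F, e \subset X]].
exists F, D; split=> //.
- by apply/subsetP => e; rewrite inE => /andP[].
- apply: (@leq_trans #|\bigcup_(X in F) powerset X|).
    apply: subset_leq_card; apply/subsetP => e.
    rewrite inE => /andP[_ /exists_inP[X XF eX]].
    by apply/bigcupP; exists X; rewrite ?inE.
  apply: leq_trans (_ : (\sum_(X in F) #|powerset X| <= _)%N).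
    elim/big_rec2: _ => [|X m A _ IH]; first by rewrite cards0.
    by apply: leq_trans (leq_card_setU _ _) _; rewrite leq_add2l.
  rewrite -sum_nat_const; apply: leq_sum => X XF.
  by have := subsetP FK X XF; rewrite inE card_powerset => /andP[/eqP -> _].
apply/setP => K; rewrite in_set0; apply/negP => /cliques_del_edges[KG KD].
have KX X : X \in F -> (#|K :&: X| <= 1)%N.
  move=> XF; rewrite leqNgt; apply/negP => /card_gt1P[x [y [xK yK xy]]].
  move: xK yK; rewrite !inE => /andP[xK xX] /andP[yK yX].
  have := KD x y xK yK xy; rewrite inE.
  move: KG; rewrite inE => /andP[_ /cliqueP/(_ x y xK yK xy)]; rewrite /adj => ->.
  by case/exists_inP; exists X => //; rewrite subUset !sub1set xX.
(* Otherwise [K] would meet itself in at most one vertex, against [2 <= r]. *)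
have KF : K \notin F.
  apply/negP => /KX; rewrite setIid.
  by move: KG; rewrite inE => /andP[/eqP -> _]; lia.
have PK : P (K |: F).
  rewrite /P subUset sub1set KG FK /=; apply/edge_disjointP => X Y.
  move=> /setU1P[-> | XF] /setU1P[-> | YF] XY.
  - by rewrite eqxx in XY.
  - exact: KX.
  - by rewrite setIC; apply: KX.
  - by move/edge_disjointP: dF; apply.
by move: KF; rewrite -(maxF _ PK (subsetUr _ _)) setU11.
Qed.

(** * Quantitative bounds under the degree condition *)

Section Counting.
Variables (R : realType) (r : nat).
Hypothesis hr : (3 <= r)%N.

(** The losses: [2 * r ^ 2] for each of the first [r - 3] replacements, [r] for the last one,
    [2 ^ r] for the multiplicity of each clique in the double count, and [2 ^ r] for the edges
    deleted per packed clique. *)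
Definition mu : R :=
  ((2 * r%:R ^+ 2) ^+ (r - 3) * r%:R * (2 ^ r)%:R * (2 ^ r)%:R)^-1.

Lemma mu_gt0 : 0 < mu.
Proof.
have r0 : 0 < r%:R :> R by rewrite ltr0n; lia.
have p0 : 0 < (2 ^ r)%:R :> R by rewrite ltr0n expn_gt0.
have q0 : 0 < (2 * r%:R ^+ 2) ^+ (r - 3) :> R.
  by rewrite exprn_gt0 // mulr_gt0 // exprn_gt0.
by rewrite invr_gt0 !mulr_gt0.
Qed.

Variables (alpha : R) (T : finType) (G : sgraph T).
Hypothesis alpha_gt0 : 0 < alpha.
Hypothesis min_deg :
  min_degree_ge G (((2 * r%:R - 5) / (2 * r%:R - 3) + alpha) * (#|T|)%:R).

Let n : R := (#|T|)%:R.
Let M : R := (2 / (2 * r%:R - 3) - alpha) * n.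

Lemma r_ge3 : 3 <= r%:R :> R. Proof. by rewrite ler_nat. Qed.

Lemma non_nbrs_leM x : (#|non_nbrs G x|)%:R <= M.
Proof.
have := min_deg x; rewrite /M /n -(card_non_nbrs G x) natrD => H.
have r3 := r_ge3.
have -> : 2 / (2 * r%:R - 3) = 1 - (2 * r%:R - 5) / (2 * r%:R - 3) :> R.
  by field; lra.
move: H; set q := _ / _; lra.
Qed.

(** The degree threshold enters here: the term free of [alpha] is nonnegative up to [j = r - 3],
    where it vanishes. *)
Lemma extensions_formula j :
  n - (r + j)%:R * M / 2 =
    ((r%:R - 3 - j%:R) / (2 * r%:R - 3) + alpha * (r + j)%:R / 2) * n.
Proof. have r3 := r_ge3; rewrite /M natrD; field; lra. Qed.

Lemma replacements_early X j : X \in cliques G r -> (j.+3 <= r)%N ->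
  (n / (2 * r%:R ^+ 2)) ^+ j <= (#|replacements G r X j|)%:R.
Proof.
move=> Xr; elim: j => [|j IH] jr; first by rewrite expr0 replacements0 // cards1.
have r3 := r_ge3.
have n0 : 0 <= n by rewrite ler0n.
have r0 : 0 < r%:R :> R by lra.
have step := @replacements_step _ G r R M non_nbrs_leM X j ltac:(lia).
have c : n / (2 * r%:R) <= n - (r + j)%:R * M / 2.
  rewrite extensions_formula mulrC; apply: ler_wpM2r => //.
  (* Before the last step [r - 3 - j >= 1], so the main term alone suffices and the bound is free of
     [alpha]. *)
  have jr' : j%:R + 4 <= r%:R :> R by rewrite -natrD ler_nat; lia.
  have p0 : 0 <= alpha * (r + j)%:R / 2.
    by rewrite divr_ge0 // mulr_ge0 // ltW.
  apply: (@le_trans _ _ (1 / (2 * r%:R - 3))).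
    by rewrite div1r lef_pV2 ?posrE; lra.
  have : 1 / (2 * r%:R - 3) <= (r%:R - 3 - j%:R) / (2 * r%:R - 3) :> R.
    by rewrite ler_pM2r ?invr_gt0; lra.
  by lra.
rewrite -(ler_pM2l r0); apply: le_trans step.
have -> : r%:R * (n / (2 * r%:R ^+ 2)) ^+ j.+1 =
    (n / (2 * r%:R ^+ 2)) ^+ j * (n / (2 * r%:R)).
  by rewrite exprS; field; rewrite gt_eqF.
apply: ler_pM; [|by rewrite divr_ge0 // mulr_ge0 // ltW| apply: IH; lia| exact: c].
by rewrite exprn_ge0 // divr_ge0 // mulr_ge0 // exprn_ge0 // ltW.
Qed.

Lemma replacements_last X : X \in cliques G r ->
  alpha * n ^+ (r - 2) / ((2 * r%:R ^+ 2) ^+ (r - 3) * r%:R) <=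
    (#|replacements G r X (r - 2)|)%:R.
Proof.
move=> Xr.
have r3 := r_ge3.
have n0 : 0 <= n by rewrite ler0n.
have r0 : 0 < r%:R :> R by lra.
have early := @replacements_early X (r - 3) Xr ltac:(lia).
have := @replacements_step _ G r R M non_nbrs_leM X (r - 3) ltac:(lia).
rewrite -/n; have -> : (r - 2 = (r - 3).+1)%N by lia.
move=> step.
(* Only the [alpha] term is left; its coefficient [(2 * r - 3) / 2] is at least 1. *)
have c : alpha * n <= n - (r + (r - 3))%:R * M / 2.
  rewrite extensions_formula natrD natrB //.
  apply: ler_wpM2r => //; rewrite subrr mul0r add0r.
  have : 0 <= alpha * (r%:R - 3) by rewrite mulr_ge0 ?subr_ge0 // ltW.
  have := alpha_gt0; lra.
rewrite -(ler_pM2l r0); apply: le_trans step.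
have -> : r%:R * (alpha * n ^+ (r - 3).+1 / ((2 * r%:R ^+ 2) ^+ (r - 3) * r%:R)) =
    (n / (2 * r%:R ^+ 2)) ^+ (r - 3) * (alpha * n).
  rewrite expr_div_n exprS; field.
  by rewrite (gt_eqF r0) andbT gt_eqF // exprn_gt0 // mulr_gt0 // exprn_gt0.
apply: ler_pM => //; last by rewrite mulr_ge0 // ltW.
by rewrite exprn_ge0 // divr_ge0 // mulr_ge0 // exprn_ge0 // ltW.
Qed.

Lemma packing_leq_copies (F : {set {set T}}) :
    F \subset cliques G r -> edge_disjoint F ->
  mu * alpha * n ^+ (r - 2) * ((#|F|)%:R * (2 ^ r)%:R) <=
    (#|copies (Kgraph r) G|)%:R.
Proof.
move=> FK dF.
have r0 : 0 < r%:R :> R by rewrite ltr0n; lia.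
have p0 : 0 < (2 ^ r)%:R :> R by rewrite ltr0n expn_gt0.
apply: (@le_trans _ _ (#|cliques G r|)%:R); last first.
  by rewrite ler_nat cliques_leq_copies.
rewrite -(ler_pM2r p0) -[leRHS]natrM.
apply: (@le_trans _ _ (\sum_(X in F) #|replacements G r X (r - 2)|)%:R); last first.
  by rewrite ler_nat sum_replacements_leq //; lia.
have -> : mu * alpha * n ^+ (r - 2) * ((#|F|)%:R * (2 ^ r)%:R) * (2 ^ r)%:R =
  (#|F|)%:R * (alpha * n ^+ (r - 2) / ((2 * r%:R ^+ 2) ^+ (r - 3) * r%:R)).
  have e0 : (2 * r%:R ^+ 2) ^+ (r - 3) != 0 :> R.
    by rewrite gt_eqF // exprn_gt0 // mulr_gt0 // exprn_gt0.
  move: (lt0r_neq0 p0) (lt0r_neq0 r0) e0; rewrite /mu.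
  move: (_ ^+ (r - 3)) (2 ^ r)%:R => a b b0 r0' a0.
  by field; rewrite a0 b0 r0'.
rewrite mulr_natl -sumr_const natr_sum; apply: ler_sum => X XF.
by apply: replacements_last; apply: (subsetP FK).
Qed.

Lemma few_copies_removable (eps : R) : 0 < eps ->
    (#|copies (Kgraph r) G|)%:R < mu * alpha * eps * n ^+ r ->
  can_be_made_Hfree (Kgraph r) G (eps * n ^+ 2).
Proof.
move=> eps0 few.
have [F [D [FK dF DG cD KD]]] := @edge_disjoint_packing T G r ltac:(lia).
exists D; split=> //; last first.
  apply/eqP; rewrite cards_eq0 -subset0; apply/subsetP => S /copies_cliques.
  by rewrite KD inE.
apply: le_trans (_ : (#|F| * 2 ^ r)%:R <= _); first by rewrite ler_nat.
(* If the packing bound on the deleted edges exceeded [eps * n ^ 2], the packing would force at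
   least [mu * alpha * eps * n ^ r] copies. *)
rewrite natrM leNgt; apply/negP => big.
move: few; apply/negP; rewrite -leNgt.
apply: le_trans (packing_leq_copies FK dF).
have -> : mu * alpha * eps * n ^+ r = mu * alpha * n ^+ (r - 2) * (eps * n ^+ 2).
  have {1}-> : (r = r - 2 + 2)%N by lia.
  by rewrite exprD; ring.
apply: ler_wpM2l (ltW big).
by rewrite !mulr_ge0 ?exprn_ge0 ?ler0n // ltW // mu_gt0.
Qed.

End Counting.

(** * The removal statement and the bound on [delta] *)

Unset Implicit Arguments.

(** The minimum with 1 is there because [delta] is at most 1 by definition, whereas
    [mu * alpha * eps] is unbounded; the second conjunct states removal without this cap. *)
Theorem theorem1p2 (R : realType) (r : nat) (hr : (3 <= r)%N) :
  exists mu : R, 0 < mu /\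
    forall alpha eps : R, 0 < alpha -> 0 < eps ->
      let gamma := (2 * r%:R - 5) / (2 * r%:R - 3) + alpha in
      Num.min 1 (mu * alpha * eps) <= delta eps (Kgraph r) gamma /\
      (forall (T : finType) (G : sgraph T),
         min_degree_ge G (gamma * (#|T|)%:R) ->
         (#|copies (Kgraph r) G|)%:R < mu * alpha * eps * (#|T|)%:R ^+ r ->
         can_be_made_Hfree (Kgraph r) G (eps * (#|T|)%:R ^+ 2)).
Proof.
exists (mu R r); split; first exact: mu_gt0.
move=> alpha eps a0 e0 gamma.
have removal (T : finType) (G : sgraph T) :
    min_degree_ge G (gamma * (#|T|)%:R) ->
    (#|copies (Kgraph r) G|)%:R < mu R r * alpha * eps * (#|T|)%:R ^+ r ->
    can_be_made_Hfree (Kgraph r) G (eps * (#|T|)%:R ^+ 2).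
  by move=> deg; apply: few_copies_removable.
split=> //; apply: delta_ub; split.
  rewrite ge_min lexx /= le_min ler01 /=.
  by rewrite !mulr_ge0 ?ltW // mu_gt0.
move=> T G few deg; apply: removal => //; apply: lt_le_trans few _.
by rewrite card_ord; apply: ler_wpM2r; rewrite ?exprn_ge0 // ge_min lexx orbT.
Qed.
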